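(* Let $\epsilon > 0$ be a real number. There exists an $n_0$ such that every graph with $n \ge n_0$ vertices and minimum degree at least $\left(\frac{9}{10} + \epsilon\right)n$ admits a fractional triangle decomposition.
   Context: A graph is a pair $(V,E)$ where $V$ is a finite set (the vertices) and $E$ is a set of unordered pairs of distinct elements of $V$ (the edges). The degree of a vertex is its number of neighbours. A triangle of a graph $G$ is a subgraph of $G$ isomorphic to the complete graph $K_3$. A fractional triangle decomposition of a graph $G$ is an assignment of non-negative real weights to the triangles of $G$ such that, for every edge $e$ of $G$, the sum of the weights of the triangles of $G$ that contain $e$ is equal to one. *)

(* Defs.v *)
From HB Require Import structures.
From mathcomp Require Import all_boot all_order all_algebra.
From mathcomp Require Import reals.

Set Implicit Arguments.
Unset Strict Implicit.
Unset Printing Implicit Defensive.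

Import Order.TTheory GRing.Theory Num.Theory.
Local Open Scope ring_scope.

Record graph := Graph {
  vertex :> finType;
  edges : {set {set vertex}};
  edgesP : forall e : {set vertex}, e \in edges -> #|e| = 2%N
}.

(* Loops are excluded by [edgesP]: [set v; v] is a singleton, hence not an
   edge, so a vertex is never its own neighbour. *)
Definition neighbours (G : graph) (v : G) : {set G} :=
  [set u : G | [set v; u] \in edges G].

Definition degree (G : graph) (v : G) : nat := #|neighbours v|.

Definition min_degree_ge (R : realType) (G : graph) (d : R) : Prop :=
  forall v : G, d <= (degree v)%:R.

(* A subgraph isomorphic to K_3 is determined by its three vertices, so the
   triangles of G are encoded by their vertex sets; the edges of such a
   subgraph are exactly the two-element subsets of its vertex set. *)
Definition triangle (G : graph) (t : {set G}) : bool :=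
  (#|t| == 3%N) &&
  [forall e : {set G}, (e \subset t) && (#|e| == 2%N) ==> (e \in edges G)].

(* The values of [w] on sets that are not triangles are irrelevant. *)
Definition fractional_triangle_decomposition (R : realType) (G : graph)
    (w : {set G} -> R) : Prop :=
  (forall t : {set G}, triangle t -> 0 <= w t) /\
  (forall e : {set G}, e \in edges G ->
     \sum_(t : {set G} | triangle t && (e \subset t)) w t = 1).

(* Main.v *)
Require Import Defs.
From mathcomp Require Import all_boot all_order all_algebra.
From mathcomp Require Import boolp reals.
From mathcomp Require Import ring lra.

(* Let D = (9/10 + eps) n.  Removing a triangle all of whose vertices have
   degree at least D + 2 preserves the minimum degree condition, so by induction
   we may assume that the set of vertices of degree at least D + 2 is
   triangle-free; hence it has at most 2 (n - D) elements.  By Farkas' lemma it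
   suffices to prove that an edge weighting Y which is nonnegative on every
   triangle has nonnegative total weight.  In a K_4 on a, b, c, d the two
   triangles through ab minus the two triangles through cd have weight
   2 (Y(ab) - Y(cd)), so the sum of |Y(e) - Y(f)| over the pairs e, f of opposite
   edges is bounded by a multiple of the total weight of the triangles, that is
   of sum_e t(e) Y(e) with t(e) the number of triangles through e.  Conversely,
   sum_e (t(e) - tau) Y(e), with tau the average of t, is bounded by the same
   multiple of that sum: by the layer-cake decomposition of Y this is a statement
   on cuts in the graph of opposite edges, which is where the constant 9/10
   enters.  Together these give tau * sum_e Y(e) >= 0. *)

Set Implicit Arguments.
Unset Strict Implicit.
Unset Printing Implicit Defensive.

Import Order.TTheory GRing.Theory Num.Theory.
Local Open Scope ring_scope.

(** * Farkas' lemma *)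

(* Bartl's induction on the number of generators: if [b] does not already lie
   in the cone of [s], project along a separating direction [y0] of [s]. *)
Lemma farkas (R : realFieldType) (I : finType) (J : eqType) (s : seq J)
    (a : J -> I -> R) (b : I -> R) :
    uniq s ->
    (forall y : I -> R, (forall j, j \in s -> 0 <= \sum_i a j i * y i) ->
       0 <= \sum_i b i * y i) ->
  exists2 l : J -> R, forall j, 0 <= l j &
    forall i, b i = \sum_(j <- s) l j * a j i.
Proof.
elim: s a b => [|j0 s IHs] a b /= => [_ hb|/andP[j0s us] hb].
  exists (fun=> 0) => // i; rewrite big_nil.
  (* Testing with [y = -b] shows that the squares of [b] have sum at most 0. *)
  have := hb (fun k => - b k) (fun _ h => match notF h with end).
  under eq_bigr do rewrite mulrN.
  rewrite sumrN oppr_ge0 => sb.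
  have b2_ge0 k : true -> 0 <= b k * b k by rewrite -expr2 sqr_ge0.
  have sb0 : \sum_k b k * b k == 0 by rewrite eq_le sb sumr_ge0.
  move: sb0; rewrite psumr_eq0 // => /allP/(_ i (mem_index_enum i)).
  by rewrite /= mulf_eq0 orbb => /eqP.
have [hs|hs] := pselect (forall y : I -> R,
    (forall j, j \in s -> 0 <= \sum_i a j i * y i) -> 0 <= \sum_i b i * y i).
  have [l l_ge0 bE] := IHs a b us hs.
  exists (fun j => if j == j0 then 0 else l j) => [j|i]; first by case: eqP.
  rewrite big_cons eqxx mul0r add0r bE !big_seq; apply: eq_bigr => j js.
  by case: eqP => // jj0; rewrite -jj0 js in j0s.
have [y0 [ay0 by0]] : exists y0 : I -> R,
    (forall j, j \in s -> 0 <= \sum_i a j i * y0 i) /\ \sum_i b i * y0 i < 0.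
  apply: contrapT => h; apply: hs => y hy; rewrite leNgt; apply/negP => hby.
  by apply: h; exists y.
pose c := \sum_i a j0 i * y0 i.
have c_lt0 : c < 0.
  rewrite ltNge; apply/negP => c_ge0; move: by0; rewrite ltNge => /negP; apply.
  by apply: hb => j; rewrite inE => /predU1P[->|/ay0].
pose p (f : I -> R) := (\sum_i f i * y0 i) / c.
have dotB (f g u : I -> R) k : \sum_i (f i - k * g i) * u i =
    \sum_i f i * u i - k * \sum_i g i * u i.
  by rewrite mulr_sumr -sumrB; apply: eq_bigr => i _; ring.
have [||l l_ge0 bE] :=
    IHs (fun j i => a j i - p (a j) * a j0 i) (fun i => b i - p b * a j0 i) => //.
  move=> y hy.
  (* Moving [y] along [y0] makes it orthogonal to [a j0], so the constraint at [j0] holds with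
     equality. *)
  pose y' i := y i - (\sum_i a j0 i * y i) / c * y0 i.
  have dotE (f : I -> R) : \sum_i f i * y' i =
      \sum_i (f i - p f * a j0 i) * y i.
    transitivity (\sum_i f i * y i - (\sum_i a j0 i * y i) / c * \sum_i f i * y0 i).
      by rewrite mulr_sumr -sumrB; apply: eq_bigr => i _; rewrite /y'; ring.
    by rewrite dotB /p; ring.
  rewrite -dotE; apply: hb => j; rewrite inE => /predU1P[->|js].
    by rewrite dotE dotB /p divff ?lt_eqF // mul1r subrr.
  by rewrite dotE; exact: hy.
(* The coefficient of [a j0] obtained by undoing the projection. It is nonnegative: as [c < 0],
   [p b] is positive and [p (a j)] is nonpositive for [j] in [s]. *)
pose l0 := p b - \sum_(j <- s) l j * p (a j).
exists (fun j => if j == j0 then l0 else l j) => [j|i].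
  case: eqP => // _; rewrite subr_ge0.
  apply: (@le_trans _ _ 0); last by rewrite mulr_le0 ?invr_le0 ?ltW.
  rewrite big_seq; apply: sumr_le0 => j' /ay0 h.
  by rewrite mulr_ge0_le0 // mulr_ge0_le0 // invr_le0 ltW.
rewrite big_cons eqxx.
have -> : \sum_(j <- s) (if j == j0 then l0 else l j) * a j i =
    \sum_(j <- s) l j * a j i.
  rewrite !big_seq; apply: eq_bigr => j js.
  by case: eqP => // jj0; rewrite -jj0 js in j0s.
rewrite -[LHS](subrK (p b * a j0 i)) bE /l0.
under eq_bigr do rewrite mulrBr mulrA.
by rewrite sumrB -mulr_suml; ring.
Qed.

(** * Total variation and cuts *)

(* Layer-cake argument, by induction on the support of [y]: subtract from [y] its
   minimum on the support. *)
Lemma coarea_le (R : realFieldType) (P : finType) (g : P -> R) (r : P -> P -> R) :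
    \sum_p g p = 0 ->
    (forall A : {set P}, \sum_(p in A) g p <=
       \sum_p \sum_p' r p p' * `|(p \in A)%:R - (p' \in A)%:R|) ->
  forall y : P -> R,
    \sum_p g p * y p <= \sum_p \sum_p' r p p' * `|y p - y p'|.
Proof.
move=> g0 cut.
suff pos k (y : P -> R) : (#|[set p | y p != 0%R]| < k)%N -> (forall p, 0 <= y p) ->
    \sum_p g p * y p <= \sum_p \sum_p' r p p' * `|y p - y p'|.
  (* Adding a constant to [y] changes neither side, since [g] sums to zero; hence [y] may be taken
     nonnegative. *)
  move=> y; pose B := \sum_p `|y p|.
  have yB p : 0 <= y p + B.
    rewrite /B (bigD1 p) //= addrA addr_ge0 ?sumr_ge0 //.
    by rewrite -lerBlDl sub0r -normrN ler_norm.
  have := pos _ _ (ltnSn _) yB.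
  under eq_bigr do rewrite mulrDr.
  rewrite big_split /= -mulr_suml g0 mul0r addr0 => /le_trans; apply.
  apply: ler_sum => p _; apply: ler_sum => p' _.
  by rewrite opprD addrACA subrr addr0.
elim: k y => // k IHk y; rewrite ltnS => yk y_ge0.
pose A := [set p | y p != 0].
have [A0|[p0 p0A]] := set_0Vmem A.
  have y0 p : y p = 0 by apply/eqP; have := in_set0 p; rewrite -A0 inE => /negbFE.
  rewrite big1 => [|p _]; last by rewrite y0 mulr0.
  rewrite big1 // => p _; rewrite big1 // => p' _.
  by rewrite !y0 subrr normr0 mulr0.
case: (@arg_minP _ _ _ p0 (mem A) y p0A) => p1 p1m y1.
have p1A : p1 \in A := p1m.
pose c := y p1; have c_ge0 : 0 <= c by exact: y_ge0.
pose y' p := y p - c * (p \in A)%:R.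
have yE p : y p = y' p + c * (p \in A)%:R by rewrite subrK.
have y'0 p : p \notin A -> y p = 0 by rewrite inE negbK => /eqP.
have y'_ge0 p : 0 <= y' p.
  rewrite /y'; case: (boolP (p \in A)) => [pA|_]; rewrite ?mulr0 ?subr0 //.
  by rewrite mulr1 subr_ge0 y1.
have lt : (#|[set p | y' p != 0%R]| < k)%N.
  apply: leq_trans yk; apply: proper_card; apply/properP; split.
    apply/subsetP => p; rewrite !inE; apply: contra => /eqP yp.
    by rewrite /y' inE yp eqxx mulr0 subr0.
  exists p1; first exact: p1A.
  by rewrite inE /y' p1A mulr1 subrr eqxx.
have -> : \sum_p g p * y p = \sum_p g p * y' p + c * \sum_(p in A) g p.
  rewrite [\sum_(p in A) _]big_mkcond mulr_sumr -big_split /=.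
  by apply: eq_bigr => p _; rewrite [y p]yE; case: (p \in A) => /=; ring.
apply: (@le_trans _ _ (\sum_p \sum_p' r p p' * `|y' p - y' p'| +
   c * \sum_p \sum_p' r p p' * `|(p \in A)%:R - (p' \in A)%:R|)).
  by rewrite lerD ?IHk // ler_wpM2l.
rewrite le_eqVlt; apply/orP; left; apply/eqP.
rewrite mulr_sumr -big_split /=; apply: eq_bigr => p _.
rewrite mulr_sumr -big_split /=; apply: eq_bigr => p' _.
(* The variation splits exactly: [y'] is nonnegative and vanishes off [A], so across the boundary of
   [A] its difference and that of the layer have the same sign. *)
rewrite mulrCA -mulrDr; congr (_ * _).
rewrite [y p]yE [y p']yE; have := y'_ge0 p; have := y'_ge0 p'.
have z q : q \notin A -> y' q = 0 by move=> qA; rewrite /y' y'0 // (negbTE qA) mulr0 subr0.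
case: (boolP (p \in A)) => pA; case: (boolP (p' \in A)) => p'A h1 h2;
  rewrite ?(z _ pA) ?(z _ p'A) ?subrr ?normr0 ?mulr0 ?mulr1 ?addr0
    ?sub0r ?subr0 ?normrN ?normr1 ?mulr1 //.
- by congr `|_|; ring.
- by rewrite (ger0_norm h2) (ger0_norm (addr_ge0 h2 c_ge0)).
- by rewrite (ger0_norm h1) (ger0_norm (addr_ge0 h1 c_ge0)).
Qed.

Lemma sumr2_sep (R : realFieldType) (P : finType) (A B : {set P}) (f g : P -> R) :
  \sum_(p in A) \sum_(q in B) (f p + g q) =
  #|B|%:R * (\sum_(p in A) f p) + #|A|%:R * \sum_(q in B) g q.
Proof.
under eq_bigr do rewrite big_split /= sumr_const.
by rewrite big_split /= sumr_const sumrMnl !mulr_natl.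
Qed.

(** By [coarea_le] it suffices to treat indicators of sets [A]. Since [o <= 1], a point of [A :&: E]
    sends to [E :\: A] at least its total weight minus [#|A :&: E|], and symmetrically. Summing the
    hypothesis on [c] over all pairs across the cut compares these bounds with the surplus of [t] on
    [A :&: E]. *)
Lemma dirichlet_ge (R : realFieldType) (P : finType) (E : {set P})
    (o : P -> P -> R) (t : P -> R) (c : R) :
    (forall p q, 0 <= o p q <= 1) ->
    (forall p q, o p q = o q p) ->
    (forall p q, q \notin E -> o p q = 0) ->
    (forall p q, p \in E -> q \in E ->
       c * (t p - t q) <= \sum_u o p u + \sum_u o q u - #|E|%:R) ->
  forall y : P -> R,
    2 * c * (\sum_(p in E) (#|E|%:R * t p - \sum_(q in E) t q) * y p) <=
    #|E|%:R * \sum_p \sum_q o p q * `|y p - y q|.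
Proof.
move=> o01 oC oE ct y.
pose M : R := #|E|%:R; pose S := \sum_(q in E) t q.
pose g p := if p \in E then 2 * c * (M * t p - S) else 0.
have -> : 2 * c * (\sum_(p in E) (M * t p - S) * y p) = \sum_p g p * y p.
  rewrite mulr_sumr [LHS]big_mkcond; apply: eq_bigr => p _; rewrite /g.
  by case: ifP => _; [ring | rewrite mul0r].
rewrite mulr_sumr; under [leRHS]eq_bigr do rewrite mulr_sumr.
under [leRHS]eq_bigr do under eq_bigr do rewrite mulrA.
apply: (@coarea_le _ _ _ (fun p q => M * o p q)).
  rewrite -big_mkcond -mulr_sumr sumrB -mulr_sumr sumr_const.
  by rewrite -[S *+ _]mulr_natl subrr mulr0.
move=> A; pose A1 := A :&: E; pose B := E :\: A.
have EAB (f : P -> R) : \sum_(p in E) f p = \sum_(p in A1) f p + \sum_(p in B) f p.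
  by rewrite /A1 setIC -big_setID.
have ME : M = #|A1|%:R + #|B|%:R by rewrite -natrD /A1 setIC cardsID.
have -> : \sum_(p in A) g p = 2 * c * (M * (\sum_(p in A1) t p) - #|A1|%:R * S).
  rewrite [LHS]big_mkcond; transitivity (\sum_(p in A1) 2 * c * (M * t p - S)).
    rewrite [RHS]big_mkcond; apply: eq_bigr => p _.
    by rewrite /g inE; case: (p \in A); case: (p \in E).
  by rewrite -mulr_sumr sumrB -mulr_sumr sumr_const -[S *+ _]mulr_natl.
pose D := \sum_(p in A1) \sum_(q in B) o p q.
have DE : D = \sum_(p in B) \sum_(q in A1) o p q.
  rewrite /D exchange_big; apply: eq_bigr => p _.
  by apply: eq_bigr => q _; rewrite oC.
have osum p (C C' : {set P}) : (forall f : P -> R, \sum_(p in E) f p =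
     \sum_(p in C) f p + \sum_(p in C') f p) ->
    \sum_u o p u - #|C|%:R <= \sum_(q in C') o p q.
  move=> CC'; rewrite lerBlDl; apply: (@le_trans _ _ (\sum_(q in E) o p q)).
    rewrite [leRHS]big_mkcond; apply: ler_sum => q _.
    by case: ifP => // /negbT /oE ->.
  rewrite CC' lerD2r -sumr_const; apply: ler_sum => q _.
  by have /andP[] := o01 p q.
have D1 : \sum_(p in A1) (\sum_u o p u - #|A1|%:R) <= D.
  by apply: ler_sum => p _; apply: osum.
have D2 : \sum_(p in B) (\sum_u o p u - #|B|%:R) <= D.
  rewrite DE; apply: ler_sum => p _; apply: osum => f.
  by rewrite EAB addrC.
(* Average the two lower bounds [D1], [D2] of the cut with weights [#|B|] and
   [#|A1|]. *)
have MD : c * (M * (\sum_(p in A1) t p) - #|A1|%:R * S) <= M * D.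
  have -> : c * (M * (\sum_(p in A1) t p) - #|A1|%:R * S) =
      \sum_(p in A1) \sum_(q in B) (c * t p + - c * t q).
    by rewrite sumr2_sep -!mulr_sumr ME /S EAB; ring.
  apply: (@le_trans _ _ (\sum_(p in A1) \sum_(q in B)
     ((\sum_u o p u - #|A1|%:R) + (\sum_u o q u - #|B|%:R)))).
    apply: ler_sum => p; rewrite inE => /andP[_ pE].
    apply: ler_sum => q; rewrite inE => /andP[_ qE].
    have := ct p q pE qE; rewrite -/M ME; lra.
  by rewrite sumr2_sep ME mulrDl addrC lerD // ler_wpM2l.
(* Each pair across the cut occurs in both orders, hence [D + D] and the factor 2 on the left. *)
apply: (@le_trans _ _ (M * (D + D))).
  by rewrite [leRHS](_ : _ = 2 * (M * D)); [rewrite -mulrA ler_pM2l | ring].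
rewrite {2}DE /D big_mkcond [X in _ + X]big_mkcond -big_split mulr_sumr.
have M0 : 0 <= M by [].
apply: ler_sum => p _ /=.
have -> : (if p \in A1 then \sum_(q in B) o p q else 0) +
    (if p \in B then \sum_(q in A1) o p q else 0) =
    \sum_q o p q * ((p \in A1) && (q \in B) || (p \in B) && (q \in A1))%:R.
  rewrite [X in if _ then X else _]big_mkcond.
  rewrite [X in _ + if _ then X else _]big_mkcond !inE.
  have mul_if q (x : bool) : o p q * x%:R = if x then o p q else 0.
    by case: x; rewrite ?mulr1 ?mulr0.
  under [RHS]eq_bigr do rewrite mul_if !inE.
  case: (p \in A); case: (p \in E) => /=; rewrite ?add0r ?addr0 ?big1_eq //.
    by apply: eq_bigr => q _; rewrite orbF inE.
  by apply: eq_bigr => q _; rewrite inE.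
rewrite mulr_sumr; apply: ler_sum => q _; rewrite -mulrA ler_wpM2l //.
have /andP[o0 _] := o01 p q; apply: ler_wpM2l => //; rewrite !inE.
by case: (p \in A); case: (p \in E); case: (q \in A); case: (q \in E);
  rewrite /= ?subrr ?normr0 ?subr0 ?sub0r ?normrN ?normr1.
Qed.

(** Inclusion-exclusion, from summing [(1 - f p) * (1 - g p) >= 0]. For indicators of neighbourhoods
    it bounds the number of common neighbours from below. *)
Lemma sum_mul_ge (R : realFieldType) (P : finType) (f g : P -> R) :
    (forall p, f p <= 1) -> (forall p, g p <= 1) ->
  \sum_p f p + \sum_p g p - #|P|%:R <= \sum_p f p * g p.
Proof.
move=> f1 g1; rewrite -[#|P|%:R]sumr_const -big_split -sumrB ler_sum // => p _ /=.
have : 0 <= (1 - f p) * (1 - g p) by rewrite mulr_ge0 ?subr_ge0.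
lra.
Qed.

(** * Opposite edges in copies of K_4 *)

Section DenseGraph.
Variables (R : realFieldType) (V : finType) (adj : rel V).
Hypothesis adjC : symmetric adj.

Definition adjr (a b : V) : R := (adj a b)%:R.
Definition deg (a : V) : R := \sum_b adjr a b.
Definition codeg (a b : V) : R := \sum_c adjr a c * adjr b c.
Definition K4r (a b c d : V) : R :=
  adjr a b * adjr a c * adjr a d * adjr b c * adjr b d * adjr c d.

Lemma adjrC a b : adjr a b = adjr b a.
Proof. by rewrite /adjr adjC. Qed.

Lemma adjr_ge0 a b : 0 <= adjr a b.
Proof. exact: ler0n. Qed.

Lemma adjr_le1 a b : adjr a b <= 1.
Proof. by rewrite /adjr lern1 leq_b1. Qed.

Lemma adjr_if a b (x : R) : adjr a b * x = if adj a b then x else 0.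
Proof. by rewrite /adjr mulrb; case: (adj a b); rewrite ?mul1r ?mul0r. Qed.

Lemma K4r_ge0 a b c d : 0 <= K4r a b c d.
Proof. by rewrite /K4r !mulr_ge0 ?adjr_ge0. Qed.

(* Sums run over ordered tuples of vertices: every edge is counted twice, every
   triangle 6 times, every pair of opposite edges of a K_4 8 times. *)
Lemma sum_K4r_le (C : R) (Y : V -> V -> R) :
    (forall a b, Y a b = Y b a) ->
    (forall a b c, adj a b -> adj b c -> adj a c ->
       0 <= Y a b + Y b c + Y a c) ->
    (forall a b c, adj a b -> adj b c -> adj a c ->
       \sum_d adjr a d * adjr b d * adjr c d <= C) ->
  \sum_a \sum_b \sum_c \sum_d K4r a b c d * `|Y a b - Y c d| <=
  6 * C * \sum_a \sum_b adjr a b * codeg a b * Y a b.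
Proof.
move=> YC Ytri Ctri.
pose z a b c := Y a b + Y b c + Y a c.
pose X := \sum_a \sum_b \sum_c \sum_d K4r a b c d * z a b c.
pose tri a b c := adjr a b * adjr b c * adjr a c.
have K4E a b c d : K4r a b c d =
    tri a b c * (adjr a d * adjr b d * adjr c d) by rewrite /K4r /tri; ring.
have zK a b c d : 0 <= K4r a b c d * z a b c.
  rewrite K4E /tri /adjr; case: (boolP (adj a b)) => ab; rewrite ?mul0r //.
  case: (boolP (adj b c)) => bc; rewrite ?(mulr0, mul0r) //.
  case: (boolP (adj a c)) => ac; rewrite ?(mulr0, mul0r) //.
  by rewrite !mulr_ge0 ?ler0n // Ytri.
(* A triangle extends to a K_4 by at most [C] vertices, and its three edges contribute equal
   sums. *)
have XC : X <= 3 * C * \sum_a \sum_b adjr a b * codeg a b * Y a b.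
  apply: (@le_trans _ _ (C * \sum_a \sum_b \sum_c tri a b c * z a b c)).
    rewrite /X mulr_sumr; apply: ler_sum => a _.
    rewrite mulr_sumr; apply: ler_sum => b _.
    rewrite mulr_sumr; apply: ler_sum => c _.
    under eq_bigr do rewrite K4E mulrAC.
    rewrite -mulr_sumr mulrC /tri /adjr.
    case: (boolP (adj a b)) => ab; rewrite ?(mulr0, mul0r) //.
    case: (boolP (adj b c)) => bc; rewrite ?(mulr0, mul0r) //.
    case: (boolP (adj a c)) => ac; rewrite ?(mulr0, mul0r) //.
    by rewrite !mul1r ler_wpM2r ?Ytri // Ctri.
  rewrite [3 * C]mulrC -mulrA le_eqVlt; apply/orP; left; apply/eqP; congr (_ * _).
  pose W := \sum_a \sum_b adjr a b * codeg a b * Y a b.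
  have e1 : \sum_a \sum_b \sum_c tri a b c * Y a b = W.
    apply: eq_bigr => a _; apply: eq_bigr => b _.
    rewrite /codeg mulr_sumr mulr_suml; apply: eq_bigr => c _.
    by rewrite /tri; ring.
  have e2 : \sum_a \sum_b \sum_c tri a b c * Y b c = W.
    rewrite -e1 exchange_big; apply: eq_bigr => b _; rewrite exchange_big.
    apply: eq_bigr => c _; apply: eq_bigr => a _.
    by rewrite /tri [adjr a b]adjrC [adjr a c]adjrC; ring.
  have e3 : \sum_a \sum_b \sum_c tri a b c * Y a c = W.
    rewrite -e1; apply: eq_bigr => a _; rewrite exchange_big.
    apply: eq_bigr => b _; apply: eq_bigr => c _.
    by rewrite /tri [adjr b c]adjrC; ring.
  rewrite -/W [RHS](_ : _ = W + W + W); last by ring.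
  rewrite -{1}e1 -{1}e2 -e3 -!big_split; apply: eq_bigr => a _.
  rewrite -!big_split; apply: eq_bigr => b _; rewrite -!big_split.
  by apply: eq_bigr => c _; rewrite /z /=; ring.
(* [K4r] is invariant under permutations of its vertices, so each of the four triangles of a K_4
   gives the total [X]. *)
have x2 : \sum_a \sum_b \sum_c \sum_d K4r a b c d * z a b d = X.
  apply: eq_bigr => a _; apply: eq_bigr => b _; rewrite exchange_big.
  apply: eq_bigr => c _; apply: eq_bigr => d _.
  by rewrite /K4r [adjr d c]adjrC; ring.
have x3 : \sum_a \sum_b \sum_c \sum_d K4r a b c d * z a c d = X.
  apply: eq_bigr => a _; rewrite exchange_big; apply: eq_bigr => c _ /=.
  rewrite exchange_big; apply: eq_bigr => d _; apply: eq_bigr => b _.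
  by rewrite /K4r [adjr b c]adjrC [adjr b d]adjrC; ring.
have x4 : \sum_a \sum_b \sum_c \sum_d K4r a b c d * z b c d = X.
  rewrite exchange_big; apply: eq_bigr => b _ /=.
  rewrite exchange_big; apply: eq_bigr => c _ /=.
  rewrite exchange_big; apply: eq_bigr => d _; apply: eq_bigr => a _.
  by rewrite /K4r [adjr a c]adjrC [adjr a b]adjrC [adjr a d]adjrC; ring.
suff : \sum_a \sum_b \sum_c \sum_d K4r a b c d * `|Y a b - Y c d| <= 2 * X by lra.
(* After doubling, the bound holds termwise: [2 * (Y a b - Y c d)] equals
   [z a b c + z a b d - z a c d - z b c d], and all four are nonnegative on a K_4. *)
rewrite -(@ler_pM2l _ 2) // [leRHS](_ : _ = X + X + X + X); last by ring.
rewrite -{2}x2 -{2}x3 -{2}x4.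
rewrite mulr_sumr -!big_split; apply: ler_sum => a _.
rewrite mulr_sumr -!big_split; apply: ler_sum => b _.
rewrite mulr_sumr -!big_split; apply: ler_sum => c _.
rewrite mulr_sumr -!big_split; apply: ler_sum => d _ /=.
have := zK a b c d.
have : 0 <= K4r a b c d * z a b d.
  by have := zK a b d c; rewrite /K4r [adjr d c]adjrC; congr (_ <= _); ring.
have : 0 <= K4r a b c d * z a c d.
  have := zK a c d b; congr (_ <= _).
  by rewrite /K4r [adjr c b]adjrC [adjr d b]adjrC; ring.
have : 0 <= K4r a b c d * z b c d.
  have := zK b c d a; congr (_ <= _).
  by rewrite /K4r [adjr b a]adjrC [adjr c a]adjrC [adjr d a]adjrC; ring.
rewrite -[K4r a b c d * `|_|](ger0_norm (mulr_ge0 (K4r_ge0 a b c d) (normr_ge0 _))).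
rewrite normrM normr_id -normrM.
set k := K4r a b c d => h4 h3 h2 h1.
by rewrite /z in h1 h2 h3 h4 *; case: (ger0P (k * _)) => _; lra.
Qed.

(** * Counting under a minimum degree condition *)

Section MinDegree.
Variables (D q : R).
Hypothesis Dq : #|V|%:R = D + q.
Hypothesis degD : forall a, D <= deg a.

Lemma deg_le_card a : deg a <= #|V|%:R.
Proof. by rewrite -[leRHS]sumr_const ler_sum // => b _; rewrite adjr_le1. Qed.

Lemma codeg_le_deg a b : codeg a b <= deg a.
Proof.
by apply: ler_sum => c _; rewrite ler_piMr ?adjr_ge0 ?adjr_le1.
Qed.

Lemma codeg_ge a b : D - q <= codeg a b.
Proof.
have := sum_mul_ge (adjr_le1 a) (adjr_le1 b).
have := degD a; have := degD b; rewrite Dq /deg /codeg; lra.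
Qed.

(** Let [c] be a common neighbour of [a] and [b]. As [c] misses at most [q] vertices, at least
    [codeg a b - q] of the common neighbours remain for [d]. *)
Lemma sum_K4r_ge a b : adj a b ->
  codeg a b * (codeg a b - q) <= \sum_c \sum_d K4r a b c d.
Proof.
move=> ab; rewrite {1}/codeg mulr_suml; apply: ler_sum => c _.
have -> : \sum_d K4r a b c d =
    adjr a c * adjr b c * \sum_d adjr a d * adjr b d * adjr c d.
  rewrite mulr_sumr; apply: eq_bigr => d _.
  by rewrite /K4r (_ : adjr a b = 1) ?mul1r; [ring | rewrite /adjr ab].
rewrite ler_wpM2l ?mulr_ge0 ?adjr_ge0 //.
have h d : adjr a d * adjr b d <= 1 by rewrite mulr_ile1 ?adjr_ge0 ?adjr_le1.
have := sum_mul_ge h (adjr_le1 c); have := degD c; rewrite Dq /deg /codeg; lra.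
Qed.

Section LowTriangles.
Variable D' : R.
Hypothesis low : forall a b c, adj a b -> adj b c -> adj a c ->
  [|| deg a < D', deg b < D' | deg c < D'].

(** Common neighbours of a triangle are neighbours of its vertex of degree below [D']. This supplies
    the constant [C] of [sum_K4r_le]. *)
Lemma codeg3_le a b c : adj a b -> adj b c -> adj a c ->
  \sum_d adjr a d * adjr b d * adjr c d <= D'.
Proof.
move=> ab bc ac.
have le1 x y d : adjr x d * adjr y d <= 1.
  by rewrite mulr_ile1 ?adjr_ge0 ?adjr_le1.
have /or3P[] := low ab bc ac => /ltW; apply: le_trans; apply: ler_sum => d _.
- by rewrite -mulrA ler_piMr ?adjr_ge0.
- by rewrite mulrAC ler_piMl ?adjr_ge0.
- by rewrite ler_piMl ?adjr_ge0.
Qed.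

(* The vertices of degree at least [D'] span no triangle, whereas any [x] vertices
   with [x > 2 q] do: pick greedily, each choice excluding at most [q] vertices. *)
Lemma card_high_le : 0 <= q -> \sum_a (D' <= deg a)%R%:R <= 2 * q.
Proof.
move=> q_ge0; pose h a : R := (D' <= deg a)%R%:R; rewrite leNgt; apply/negP => hq.
have h1 a : h a <= 1 by rewrite /h lern1 leq_b1.
have h0 a : 0 <= h a by exact: ler0n.
have pos (f : V -> R) : 0 < \sum_a f a -> exists a, 0 < f a.
  move=> f_gt0; apply: contrapT => nf; move: f_gt0; rewrite ltNge => /negP; apply.
  apply: sumr_le0 => a _; rewrite leNgt; apply/negP => fa; apply: nf.
  by exists a.
have [|a ha] := pos h; first by apply: le_lt_trans hq; rewrite mulr_ge0.
have s1 := sum_mul_ge h1 (adjr_le1 a).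
have [|b hb] := pos (fun b => h b * adjr a b).
  by have := degD a; rewrite Dq /deg -/h in hq s1 *; lra.
have hm b' : h b' * adjr a b' <= 1 by rewrite mulr_ile1 ?adjr_ge0 ?adjr_le1.
have s2 := sum_mul_ge hm (adjr_le1 b).
have [|c hc] := pos (fun c => h c * adjr a c * adjr b c).
  have := degD a; have := degD b; rewrite Dq /deg -/h in hq s1 s2 *; lra.
move: ha hb hc; rewrite /h /adjr.
case: (boolP (D' <= deg a)) => [da|]; rewrite ?ltxx //.
case: (boolP (D' <= deg b)) => [db|]; rewrite ?mul0r ?ltxx //.
case: (boolP (D' <= deg c)) => [dc|]; rewrite ?mul0r ?ltxx //.
case: (boolP (adj a b)) => ab; rewrite ?mulr0 ?ltxx //.
case: (boolP (adj a c)) => ac; rewrite ?(mulr0, mul0r) ?ltxx //.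
case: (boolP (adj b c)) => bc; rewrite ?mulr0 ?ltxx //.
by have := low ab bc ac; rewrite !ltNge da db dc.
Qed.

(** At most [2 * q] vertices reach degree [D'], and each exceeds it by at most [q], since degrees
    are at most [D + q]. The left side is the number of ordered edges. *)
Lemma sum_deg_le : D <= D' -> 0 <= q ->
  \sum_a deg a <= #|V|%:R * D' + 2 * q ^+ 2.
Proof.
move=> DD' q_ge0.
apply: (@le_trans _ _ (\sum_a (D' + (D' <= deg a)%R%:R * q))).
  apply: ler_sum => a _; case: (leP D' (deg a)) => [_|/ltW da];
    rewrite ?mul0r ?mul1r ?addr0 //.
  have := deg_le_card a; rewrite Dq; lra.
rewrite big_split /= -mulr_suml sumr_const -[D' *+ _]mulr_natl lerD2l.
by rewrite expr2 mulrA ler_wpM2r // card_high_le.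
Qed.

End LowTriangles.

(** * The dual inequality *)

(* At [x = n], [y = n - 2 q] the difference of the two sides is
   [(n - q) * (n - 10 * q) - 12 * q - 2 * n]. *)
Lemma codeg_quadratic (n x y : R) :
    0 <= q -> 10 * q <= n -> 12 * q + 2 * n <= (n - q) * (n - 10 * q) ->
    x <= n -> n - 2 * q <= y ->
  3 * (n - q + 2) * (x - y) <=
  x * (x - q) + y * (y - q) - (n * (n - q + 2) + 2 * q ^+ 2).
Proof.
move=> q0 nq hn xn yn.
(* The difference of the two sides exceeds its value at [x = n], [y = n - 2 * q] by exactly the sum
   of the products in [hx] and [hy]. *)
have hx : 0 <= (n - x) * (2 * n - 2 * q + 6 - x) by rewrite mulr_ge0; lra.
have hy : 0 <= (y - (n - 2 * q)) * (y + (n - 2 * q) - q + 3 * (n - q + 2)).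
  by rewrite mulr_ge0; lra.
lra.
Qed.

Lemma sum_weight_ge0 (Y : V -> V -> R) :
    let n := #|V|%:R : R in
    0 <= q -> 10 * q <= n -> 12 * q + 2 * n <= (n - q) * (n - 10 * q) ->
    (forall a b c, adj a b -> adj b c -> adj a c ->
       [|| deg a < D + 2, deg b < D + 2 | deg c < D + 2]) ->
    (forall a b, Y a b = Y b a) ->
    (forall a b c, adj a b -> adj b c -> adj a c ->
       0 <= Y a b + Y b c + Y a c) ->
  0 <= \sum_a \sum_b adjr a b * Y a b.
Proof.
move=> n q0 nq hn low YC Ytri.
case: (pickP (@predT V)) => [a0 _|V0]; last by rewrite big_pred0.
have n_ge1 : 1 <= n by rewrite ler1n; apply/card_gt0P; exists a0.
have nD : n = D + q := Dq.
pose E := [set p : V * V | adj p.1 p.2].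
pose t (p : V * V) := codeg p.1 p.2.
pose y (p : V * V) := Y p.1 p.2.
pose o (p r : V * V) := K4r p.1 p.2 r.1 r.2.
have sumE (f : V -> V -> R) :
    \sum_(p in E) f p.1 p.2 = \sum_a \sum_b adjr a b * f a b.
  rewrite pair_big big_mkcond; apply: eq_bigr => -[a b] _ /=.
  by rewrite adjr_if inE.
have cardE : #|E|%:R <= n * (n - q + 2) + 2 * q ^+ 2.
  rewrite -sumr_const (sumE (fun _ _ => 1)).
  under eq_bigr do under eq_bigr do rewrite mulr1.
  apply: le_trans (sum_deg_le low _ q0) _; first by lra.
  rewrite lerD2r -/n; rewrite (_ : D + 2 = n - q + 2) //; lra.
have osum p : p \in E -> t p * (t p - q) <= \sum_r o p r.
  rewrite inE => pE; apply: le_trans (sum_K4r_ge pE) _.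
  by rewrite pair_big.
have [E0|[p0 p0E]] := set_0Vmem E.
  by rewrite -(sumE Y) E0 big_set0.
have t_ge p : n - 2 * q <= t p by have := codeg_ge p.1 p.2; rewrite /t; lra.
have t_le p : t p <= n by apply: le_trans (codeg_le_deg _ _) (deg_le_card _).
pose S := \sum_(p in E) t p.
have S_gt0 : 0 < S.
  rewrite /S (bigD1 p0) //= ltr_pwDl ?sumr_ge0 // => [|p _].
    by apply: lt_le_trans (t_ge _); lra.
  by apply: le_trans (t_ge _); lra.
have M_gt0 : 0 < #|E|%:R :> R by rewrite ltr0n; apply/card_gt0P; exists p0.
(* The choice [c = 3 * (D + 2)] makes [2 * c] equal to the factor [6 * C] of [sum_K4r_le] at
   [C = D + 2]. *)
have h2 : 2 * (3 * (D + 2)) * (\sum_(p in E) (#|E|%:R * t p - S) * y p) <=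
    #|E|%:R * \sum_p \sum_r o p r * `|y p - y r|.
  apply: dirichlet_ge.
  - move=> p r; rewrite K4r_ge0 /o /K4r.
    by rewrite !(mulr_ile1, mulr_ge0, adjr_ge0, adjr_le1).
  - move=> p r; rewrite /o /K4r.
    rewrite [adjr r.1 p.1]adjrC [adjr r.1 p.2]adjrC [adjr r.2 p.1]adjrC.
    by rewrite [adjr r.2 p.2]adjrC; ring.
  - by move=> p r; rewrite inE /o /K4r /adjr => /negbTE ->; rewrite mulr0.
  - move=> p r pE rE.
    have := codeg_quadratic q0 nq hn (t_le p) (t_ge r).
    have := osum p pE; have := osum r rE.
    by rewrite (_ : n - q + 2 = D + 2) in cardE *; lra.
have := @sum_K4r_le (D + 2) Y YC Ytri (codeg3_le low).
have -> : \sum_a \sum_b \sum_c \sum_d K4r a b c d * `|Y a b - Y c d| =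
    \sum_p \sum_r o p r * `|y p - y r|.
  rewrite pair_big; apply: eq_bigr => -[a b] _ /=; by rewrite pair_big.
have -> : \sum_a \sum_b adjr a b * codeg a b * Y a b = \sum_(p in E) t p * y p.
  rewrite (sumE (fun a b => codeg a b * Y a b)).
  by apply: eq_bigr => a _; apply: eq_bigr => b _; rewrite mulrA.
rewrite -(sumE Y) => h1.
have {h1 h2} := le_trans h2 (ler_wpM2l (ltW M_gt0) h1).
under [X in 2 * _ * X]eq_bigr do rewrite mulrBl -mulrA.
rewrite sumrB -!mulr_sumr.
set T := \sum_(p in E) t p * y p; set Z := \sum_(p in E) y p => h.
(* The terms [6 * (D + 2) * #|E| * T] on the two sides of [h] cancel. *)
have {h} : 0 <= (6 * (D + 2) * S) * Z by lra.
by rewrite pmulr_rge0 // !mulr_gt0 //; lra.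
Qed.

End MinDegree.
End DenseGraph.

(** * From edge sets to adjacency relations *)

Definition adjacent (G : graph) (a b : G) : bool := [set a; b] \in edges G.

Lemma adjacentC (G : graph) : symmetric (@adjacent G).
Proof. by move=> a b; rewrite /adjacent setUC. Qed.

Lemma adjacent_neq (G : graph) (a b : G) : adjacent a b -> a != b.
Proof. by move=> /edgesP; rewrite cards2; case: eqP. Qed.

Lemma deg_degree (R : realFieldType) (G : graph) (a : G) :
  deg R (@adjacent G) a = (degree a)%:R.
Proof.
rewrite /degree -sum1_card natr_sum [RHS]big_mkcond; apply: eq_bigr => b _.
by rewrite inE /adjr /adjacent; case: ifP.
Qed.

Lemma subset3_card2 (T : finType) (a b c : T) (e : {set T}) :
    e \subset [set a; b; c] -> #|e| = 2%N ->
  [\/ e = [set a; b], e = [set b; c] | e = [set a; c]].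
Proof.
move=> sub /eqP/cards2P[x [y [xy e2]]]; move: sub; rewrite e2 subUset !sub1set !inE.
move=> /andP[/orP[/orP[]|]/eqP xE /orP[/orP[]|]/eqP yE];
  move: xy; rewrite xE yE ?eqxx // => _.
- exact: Or31.
- exact: Or33.
- by rewrite setUC; exact: Or31.
- exact: Or32.
- by rewrite setUC; exact: Or33.
- by rewrite setUC; exact: Or32.
Qed.

Lemma triangle_set3 (G : graph) (a b c : G) :
  adjacent a b -> adjacent b c -> adjacent a c -> triangle [set a; b; c].
Proof.
move=> ab bc ac; apply/andP; split.
  rewrite setUC cardsU1 cards2 !inE (adjacent_neq ab).
  by rewrite ![c == _]eq_sym (negbTE (adjacent_neq bc)) (negbTE (adjacent_neq ac)).
apply/forallP => e; apply/implyP => /andP[sub /eqP e2].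
by have [->|->|->] := subset3_card2 sub e2.
Qed.

Lemma triangle_ex (G : graph) (t : {set G}) : triangle t ->
  exists a b c, [/\ t = [set a; b; c], adjacent a b, adjacent b c & adjacent a c].
Proof.
move=> /andP[/eqP t3 /forallP tE].
have [a aT] : exists a, a \in t by apply/card_gt0P; rewrite t3.
have /cards2P[b [c [bc tbc]]] : #|t :\ a| == 2%N.
  by move: t3; rewrite (cardsD1 a) aT add1n => -[->].
have tabc : t = [set a; b; c] by rewrite -(setD1K aT) tbc setUA.
have /andP[ab ac] : (a != b) && (a != c).
  by rewrite -negb_or -in_set2 -tbc !inE eqxx.
exists a, b, c; rewrite /adjacent; split=> //.
- by apply: (implyP (tE _)); rewrite cards2 ab tabc subUset !sub1set !inE !eqxx ?orbT.
- by apply: (implyP (tE _)); rewrite cards2 bc tabc subUset !sub1set !inE !eqxx ?orbT.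
- by apply: (implyP (tE _)); rewrite cards2 ac tabc subUset !sub1set !inE !eqxx ?orbT.
Qed.

Lemma sum_edges_triangle (R : realFieldType) (G : graph) (y : {set G} -> R) (a b c : G) :
    adjacent a b -> adjacent b c -> adjacent a c ->
  \sum_e ((e \in edges G) && (e \subset [set a; b; c]))%:R * y e =
  y [set a; b] + y [set b; c] + y [set a; c].
Proof.
move=> ab bc ac.
have nab := adjacent_neq ab; have nbc := adjacent_neq bc; have nac := adjacent_neq ac.
rewrite (bigD1 [set a; b]) //= (bigD1 [set b; c]) /=; last first.
  apply: contraNneq nab => /setP/(_ a).
  by rewrite !inE eqxx (negbTE nac) orbF => ->.
rewrite (bigD1 [set a; c]) /=; last first.
  apply/andP; split.
    apply: contraNneq nbc => /setP/(_ c); rewrite !inE eqxx orbT.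
    by rewrite ![c == _]eq_sym (negbTE nac) /= => <-.
  apply: contraNneq nab => /setP/(_ a).
  by rewrite !inE eqxx (negbTE nac) !orbF /= => <-.
rewrite big1 ?addr0 => [|e /andP[/andP[e1 e2] e3]].
  rewrite -!/(adjacent _ _) ab bc ac !subUset !sub1set !inE !eqxx ?orbT /=.
  by rewrite !mul1r addrA.
case: (boolP (e \in edges G)) => [eE|_]; last by rewrite mul0r.
case: (boolP (e \subset _)) => [sub|_]; last by rewrite mul0r.
by have [/eqP|/eqP|/eqP] := subset3_card2 sub (edgesP eE);
  rewrite ?(negbTE e1) ?(negbTE e2) ?(negbTE e3).
Qed.

Lemma sum_adjacent (R : realFieldType) (G : graph) (y : {set G} -> R) :
  \sum_a \sum_b adjr R (@adjacent G) a b * y [set a; b] =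
  2 * \sum_(e in edges G) y e.
Proof.
under eq_bigr do under eq_bigr do rewrite adjr_if.
rewrite pair_big -big_mkcond /=.
rewrite (partition_big (fun p => [set p.1; p.2]) (mem (edges G))) //=.
rewrite mulr_sumr; apply: eq_bigr => e eE.
have /eqP/cards2P[x [z [xz e2]]] := edgesP eE.
transitivity (\sum_(p in [set (x, z); (z, x)]) y e); last first.
  by rewrite sumr_const cards2 xpair_eqE (negbTE xz) mulr_natl.
apply: eq_big => [[a b]|[a b] /andP[_ /eqP ->]] //=.
rewrite !inE !xpair_eqE /adjacent; apply/idP/idP.
  move=> /andP[ab /eqP abe]; have := adjacent_neq ab => nab.
  have : a \in e by rewrite -abe !inE eqxx.
  have : b \in e by rewrite -abe !inE eqxx orbT.
  rewrite e2 !inE => /orP[]/eqP bE /orP[]/eqP aE; rewrite aE bE ?eqxx ?orbT //.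
    by rewrite aE bE eqxx in nab.
  by rewrite aE bE eqxx in nab.
move=> /orP[]/andP[/eqP -> /eqP ->]; rewrite -?e2 ?eE ?eqxx //.
by rewrite setUC -e2 eE eqxx.
Qed.

(** * Deleting the edges of a triangle *)

Section RemoveTriangle.
Variables (G : graph) (T : {set G}).
Hypothesis triT : triangle T.

Lemma remove_edgesP (e : {set G}) :
  e \in edges G :\: powerset T -> #|e| = 2%N.
Proof. by rewrite inE => /andP[_ /edgesP]. Qed.

Definition remove_triangle : graph := Graph remove_edgesP.

Lemma card_edges_remove : (#|edges remove_triangle| < #|edges G|)%N.
Proof.
apply: proper_card; apply/properP; split; first exact: subsetDl.
have [a [b [c [TE ab _ _]]]] := triangle_ex triT.
exists [set a; b] => //; rewrite !inE TE negb_and negbK.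
by rewrite subUset !sub1set !inE !eqxx ?orbT.
Qed.

Lemma degree_remove_out (v : G) : v \notin T -> @degree remove_triangle v = degree v.
Proof.
move=> vT; apply: eq_card => u; rewrite !inE subUset sub1set (negbTE vT).
by [].
Qed.

Lemma degree_remove_in (v : G) : v \in T -> (degree v <= @degree remove_triangle v + 2)%N.
Proof.
move=> vT; have T2 : #|T :\ v| = 2%N.
  by have /andP[/eqP] := triT; rewrite (cardsD1 v) vT => -[].
rewrite -T2; apply: leq_trans (leq_card_setU _ _).
apply: subset_leq_card; apply/subsetP => u; rewrite !inE subUset !sub1set vT /=.
move=> vu; rewrite vu andbT; case: (u \in T) => //=.
by rewrite ?andbT ?orbF eq_sym; exact: adjacent_neq.
Qed.

(** Weight 1 on [T] covers the deleted edges. Every other triangle that shares an edge with [T] gets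
    weight 0, and the remaining ones keep their weight. *)
Lemma remove_triangle_decomposition (R : realType) (w : {set remove_triangle} -> R) :
  fractional_triangle_decomposition w ->
  exists w' : {set G} -> R, fractional_triangle_decomposition w'.
Proof.
move=> [w_ge0 w1].
pose w' (t : {set G}) : R :=
  if t == T then 1 else if @triangle remove_triangle t then w t else 0.
have triE (t : {set G}) : @triangle remove_triangle t -> triangle t.
  move=> /andP[t3 /forallP tE]; apply/andP; split=> //; apply/forallP => e.
  by have := tE e; case: (_ && _) => //=; rewrite inE => /andP[].
have tri_edge (t e : {set G}) : @triangle remove_triangle t -> e \subset t -> e \in edges G ->
    e \in edges remove_triangle.
  move=> /andP[_ /forallP/(_ e)/implyP h] et /edgesP e2; apply: h.
  by rewrite et e2 eqxx.
have TnE (e : {set G}) : e \subset T -> e \notin edges remove_triangle.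
  by move=> eT; rewrite !inE eT.
have Tn : ~~ @triangle remove_triangle T.
  have [a [b [c [TE ab _ _]]]] := triangle_ex triT.
  have abT : [set a; b] \subset T.
    by rewrite TE subUset !sub1set !inE !eqxx ?orbT.
  by apply: contraL (TnE _ abT) => h; rewrite negbK (tri_edge T).
exists w'; split=> [t tt|e eE].
  by rewrite /w'; case: ifP => // _; case: ifP => // /w_ge0.
have [eT|eT] := boolP (e \subset T).
  rewrite (bigD1 T) ?triT //= /w' eqxx big1 ?addr0 // => t /andP[/andP[_ et] /negbTE ->].
  case: ifP => // tt; have := TnE _ eT; by rewrite (tri_edge t).
have eE' : e \in edges remove_triangle by rewrite !inE eT.
rewrite -(w1 _ eE') [LHS]big_mkcond [RHS]big_mkcond; apply: eq_bigr => t _ /=.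
case: (boolP (e \subset t)) => et; rewrite ?andbF // !andbT /w'.
case: eqP => [tT|_]; first by rewrite -tT et in eT.
by case: (boolP (@triangle remove_triangle t)) => [/triE -> //|_]; case: ifP.
Qed.

End RemoveTriangle.

(** * Duality and the induction *)

Lemma farkas_decomposition (R : realType) (G : graph) :
    (forall Y : G -> G -> R, (forall a b, Y a b = Y b a) ->
      (forall a b c, adjacent a b -> adjacent b c -> adjacent a c ->
         0 <= Y a b + Y b c + Y a c) ->
      0 <= \sum_a \sum_b adjr R (@adjacent G) a b * Y a b) ->
  exists w : {set G} -> R, fractional_triangle_decomposition w.
Proof.
move=> dual.
(* The generators are the edge-incidence vectors of the triangles and the target is the indicator of
   the edge set; coordinates at non-edges read [0 = 0]. *)
have [|y hy|l l_ge0 lE] := @farkas R {set G} {set G} (enum (@triangle G))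
  (fun t e => ((e \in edges G) && (e \subset t))%:R)
  (fun e => (e \in edges G)%:R).
- exact: enum_uniq.
- have -> : \sum_e (e \in edges G)%:R * y e = \sum_(e in edges G) y e.
    rewrite [RHS]big_mkcond; apply: eq_bigr => e _.
    by case: ifP; rewrite ?mul1r ?mul0r.
  rewrite -(pmulr_rge0 _ (ltr0Sn R 1)) -sum_adjacent.
  apply: dual => [a b|a b c ab bc ac]; first by rewrite setUC.
  rewrite -sum_edges_triangle //; apply: hy; rewrite mem_enum.
  exact: triangle_set3.
exists l; split=> // e eE.
have -> : 1 = \sum_(t <- enum (@triangle G)) l t * (e \subset t)%:R.
  by have := lE e; rewrite eE.
rewrite big_enum [LHS]big_mkcondr; apply: eq_bigr => t _ /=.
by case: ifP; rewrite ?mulr1 ?mulr0.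
Qed.

Theorem theorem5 (R : realType) (eps : R) (eps_gt0 : 0 < eps) :
  exists n0 : nat, forall G : graph,
    (n0 <= #|G|)%N ->
    min_degree_ge G ((9%:R / 10%:R + eps) * #|G|%:R) ->
    exists w : {set G} -> R, fractional_triangle_decomposition w.
Proof.
(* This forces [eps * n >= 1], so that [n - 10 * q = 10 * eps * n >= 10] for [q = n - D]. *)
exists (Num.truncn eps^-1).+1 => G.
have [n Gn] : exists n, #|G| = n by exists #|G|.
rewrite Gn => nn0 Gdeg.
have n_gt0 : 0 < n%:R :> R by rewrite ltr0n (leq_ltn_trans _ nn0).
have epsn : 1 <= eps * n%:R.
  rewrite -ler_pdivrMl // mulr1 ltW //; apply: lt_le_trans (truncnS_gt _) _.
  by rewrite ler_nat.
pose D : R := (9 / 10 + eps) * n%:R.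
have {Gdeg} : forall v : G, D <= (degree v)%:R by [].
(* The vertex set never changes, so [D] stays fixed while the number of edges drops. *)
have [k] := ubnP #|edges G|; elim: k G Gn => // k IHk G Gn Ek Gdeg.
have [[T [triT hT]]|noT] := pselect (exists T : {set G}, triangle T /\
    forall v, v \in T -> D + 2 <= (degree v)%:R).
  have [||w /remove_triangle_decomposition] := IHk (remove_triangle T) Gn _ _ => //.
  - by apply: leq_trans (card_edges_remove triT) _; rewrite -ltnS.
  - move=> v; have [vT|vT] := boolP (v \in T).
      rewrite -(lerD2r 2) (le_trans (hT v vT)) // -natrD ler_nat.
      exact: degree_remove_in.
    by rewrite degree_remove_out.
  exact.
pose q : R := n%:R - D.
have q_ge0 : 0 <= q.
  have /card_gt0P[v _] : (0 < #|G|)%N by rewrite Gn; move: n_gt0; rewrite ltr0n.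
  rewrite subr_ge0 (le_trans (Gdeg v)) // ler_nat -Gn; exact: max_card.
have Dq : #|G|%:R = D + q by rewrite Gn /q; ring.
have degD (a : G) : D <= deg R (@adjacent G) a by rewrite deg_degree.
apply: farkas_decomposition => Y YC Ytri.
apply: (sum_weight_ge0 (@adjacentC G) Dq degD) => //.
- rewrite Gn /q /D; lra.
(* As [q <= n / 10], the left side is at most [16 * n / 5], while the right side is at least
   [9 * n]. *)
- rewrite Gn /q /D; nra.
move=> a b c ab bc ac; rewrite !deg_degree !ltNge -!negb_and.
apply/negP => /and3P[da db dc]; apply: noT.
exists [set a; b; c]; split; first exact: triangle_set3.
by move=> v; rewrite !inE => /orP[/orP[]|] /eqP ->.
Qed.
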